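(* Let $\Omega\subset\mathbb{R}^d$, let $X=\{x_1,\ldots,x_N\}\subset\Omega$ be a fixed set of pairwise distinct points, let $f:\Omega\to\mathbb{R}$ and $f_i=f(x_i)$. Suppose a transformed operator $\widetilde{\mathcal I}_X$ satisfies $(\widetilde{\mathcal I}_X f)(x_i)=f(x_i)$ for $i=1,\ldots,N$. Then the transformed scheme preserves interpolation of the values $f_i$ at $X$, independently of whether the transformation acts on the operator, the geometry, or the trial space. In particular, each of the following approximants $\widetilde{\mathcal I}_Xf$ satisfies $(\widetilde{\mathcal I}_X f)(x_i)=f_i$ for $i=1,\ldots,N$: (i) (rescaled method: normalization by an interpolant equal to one on $X$) $\widetilde{\mathcal I}_Xf=P_f/P_1$, where $P_f$ and $P_1$ are the kernel interpolants on $X$ of $f$ and of the constant function $1$; (ii) (variably scaled kernel interpolation: pullback by an injective lifting) $\widetilde{\mathcal I}_Xf=P_{1,f,\sigma(X)}\circ\sigma$, where $\sigma(x)=(x,\psi(x))\in\mathbb{R}^{d+1}$ is the lifting by a scale function $\psi:\Omega\to\mathbb{R}$ and $P_{1,f,\sigma(X)}$ is the fixed-scale kernel interpolant on $\mathbb{R}^{d+1}$ of the values $f_i$ at the points $\sigma(x_i)$; (iii) (fake-node interpolation: composition of a basis with an injective map) $\widetilde{\mathcal I}_Xf=P_g\circ S$, where $S:\Omega\to S(\Omega)$ is injective and $P_g\in\operatorname{span}\{B_1,\ldots,B_N\}$ is the interpolant at the points $S(x_i)$ of a function $g$ with $g(S(x_i))=f(x_i)$; (iv) (rational interpolation) $\widetilde{\mathcal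 I}_Xf=P_g/P_h$, where $P_g$ and $P_h$ are the numerator and denominator of a rational kernel expansion satisfying $P_g(x_i)=f_iP_h(x_i)$ and $P_h(x_i)\neq0$ for $i=1,\ldots,N$.
   Context: An approximation scheme is a triple $\mathcal A=(X,\mathcal V_X,\mathcal I_X)$ consisting of a sampling set, a finite-dimensional trial space and an interpolation/approximation operator; a mapping transformation $(M_X,M_{\mathcal V},M_{\mathcal I})$ produces the transformed scheme $(M_X(X),M_{\mathcal V}(\mathcal V_X),M_{\mathcal I}(\mathcal I_X))$, the sampled values $f_X=(f(x_1),\ldots,f(x_N))^T$ being kept fixed. ''Preserves interpolation'' means that the transformed approximant takes the value $f(x_i)$ at each $x_i$. (i) For a strictly positive definite kernel $K$ on $\Omega$ (kernel matrices at distinct points are positive definite), $P_f=\sum_j c_jK(\cdot,x_j)$ with $Ac=f_X$, $A_{ij}=K(x_i,x_j)$; $P_1$ is obtained for the data vector $(1,\ldots,1)^T$. The quotient $P_f/P_1$ is considered where $P_1\neq0$. (ii) For a strictly positive definite kernel $K$ on $\mathbb{R}^{d+1}$, $P_{1,f,\sigma(X)}=\sum_jc_jK(\cdot,\sigma(x_j))$ is the unique such combination with value $f_i$ at $\sigma(x_i)$ for all $i$. The variably scaled kernel is $K_\psi(x,y)=K(\sigma(x),\sigma(y))$. (iii) $\{B_1,\ldots,B_N\}$ is a basis of functions on $S(\Omega)$ for which interpolation at $S(x_1),\ldots,S(x_N)$ is uniquely solvable; the points $S(x_i)$ are called fake nodes. (iv) A rational kernel expansion is a quotient $P_g/P_h$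 with $P_g(x)=\sum_{i=1}^N\alpha_iK(x,x_i)+\sum_{m=1}^L\gamma_mp_m(x)$ and $P_h(x)=\sum_{k=1}^N\beta_k\overline K(x,x_k)$, where $K,\overline K$ are kernels on $\Omega$, $p_m$ are polynomials and the coefficients are real; it is considered where $P_h\ne0$. *)

(* Defs.v *)
From HB Require Import structures.
From mathcomp Require Import all_boot all_order all_algebra.
From mathcomp Require Import boolp classical_sets functions reals.
From mathcomp Require mpoly.

Set Implicit Arguments.
Unset Strict Implicit.
Unset Printing Implicit Defensive.

Import Order.TTheory GRing.Theory Num.Theory.
Local Open Scope classical_set_scope.
Local Open Scope ring_scope.

Section Interpolation.
Context {R : realType} {N : nat}.
Implicit Types T : Type.

(* The data vector f_X = (f(x_1), ..., f(x_N))^T. *)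
Definition samples T (f : T -> R) (x : 'I_N -> T) : 'cV[R]_N := \col_i f (x i).

Definition interpolates T (x : 'I_N -> T) (y : 'cV[R]_N) (P : T -> R) : Prop :=
  forall i, P (x i) = y i 0.

Definition lincomb n T (B : 'I_n -> T -> R) (c : 'cV[R]_n) : T -> R :=
  fun t => \sum_j c j 0 * B j t.

Definition lin_indep n T (B : 'I_n -> T -> R) : Prop :=
  forall c : 'cV[R]_n, (forall t, lincomb B c t = 0) -> c = 0.

Definition uniquely_solvable T (B : 'I_N -> T -> R) (x : 'I_N -> T) : Prop :=
  forall y : 'cV[R]_N, exists! c : 'cV[R]_N, interpolates x y (lincomb B c).

Definition collocation_mx n T (B : 'I_n -> T -> R) (x : 'I_n -> T) : 'M[R]_n :=
  \matrix_(i, j) B j (x i).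

(* The combination of the B_j whose coefficient vector c solves A c = y with
   A = collocation_mx B x. It is meaningful when A is invertible; [invmx] is the
   identity on singular matrices, so nothing is implied in that case. *)
Definition interpolant T (B : 'I_N -> T -> R) (x : 'I_N -> T) (y : 'cV[R]_N) :
    T -> R :=
  lincomb B (invmx (collocation_mx B x) *m y).

Definition translates T (K : T -> T -> R) (x : 'I_N -> T) : 'I_N -> T -> R :=
  fun j t => K t (x j).

Definition kernel_interpolant T (K : T -> T -> R) (x : 'I_N -> T)
    (y : 'cV[R]_N) : T -> R :=
  interpolant (translates K x) x y.

End Interpolation.

(* Symmetry is not required, so this covers both conventions for the positive
   definiteness of a real matrix. *)
Definition posdefmx (R : realType) n (A : 'M[R]_n) : Prop :=
  forall c : 'cV[R]_n, c != 0 -> 0 < (c^T *m A *m c) 0 0.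

Definition strictly_posdef (R : realType) (T : Type) (K : T -> T -> R) : Prop :=
  forall n (x : 'I_n -> T), injective x ->
    posdefmx (\matrix_(i, j) K (x i) (x j)).

(* sigma(x) = (x, psi(x)) in R^(d+1). *)
Definition lifting (R : realType) (d : nat) (Omega : set 'rV[R]_d)
    (psi : Omega -> R) : Omega -> 'rV[R]_(d + 1) :=
  fun w => row_mx (val w) (psi w)%:M.

(* S seen as a map onto its image S(Omega). *)
Definition onto_range (D T : Type) (S : D -> T) : D -> range S :=
  fun w => exist _ (S w) (mem_set (imageT S w)).

Definition rational_num (R : realType) (d N L : nat) (Omega : set 'rV[R]_d)
    (K : Omega -> Omega -> R) (p : 'I_L -> mpoly.mpoly d R)
    (x : 'I_N -> Omega) (alpha : 'cV[R]_N) (gamma : 'cV[R]_L) : Omega -> R :=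
  fun w => \sum_i alpha i 0 * K w (x i)
         + \sum_m gamma m 0 * mpoly.meval (fun k => val w 0 k) (p m).

Definition rational_den (R : realType) (N : nat) (T : Type) (K : T -> T -> R)
    (x : 'I_N -> T) (beta : 'cV[R]_N) : T -> R :=
  lincomb (translates K x) beta.

(* Finite-dimensional spaces of real functions on T. *)
Record fdspace (R : realType) (T : Type) := FdSpace {
  fd_set :> set (T -> R);
  fd_fin : exists n (b : 'I_n -> T -> R), fd_set = range (lincomb b) }.

(* Sampling set and trial space live on T, while the approximants are functions
   on D. The two agree for an untransformed scheme; they differ when the
   geometry is transformed (e.g. T = R^(d+1) or T = S(Omega)), and approximants
   are then pulled back to D. The operator acts on the data vector, since the
   sampled values are kept fixed by transformations. *)
Record approx_scheme (R : realType) (N : nat) (D T : Type) := ApproxScheme {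
  sampling : 'I_N -> T;
  trial : fdspace R T;
  operator : 'cV[R]_N -> D -> R }.

Record mapping_transformation (R : realType) (N : nat) (D T : Type) :=
  MappingTransformation {
    map_sampling : ('I_N -> D) -> 'I_N -> T;
    map_trial : fdspace R D -> fdspace R T;
    map_operator : ('cV[R]_N -> D -> R) -> 'cV[R]_N -> D -> R }.

Definition transformed (R : realType) (N : nat) (D T : Type)
    (M : mapping_transformation R N D T) (A : approx_scheme R N D D) :
    approx_scheme R N D T :=
  ApproxScheme (map_sampling M (sampling A)) (map_trial M (trial A))
               (map_operator M (operator A)).

(* The transformed approximant, built from the values of f at the original
   sampling points, takes these values at the original sampling points. *)
Definition preserves_interpolation (R : realType) (N : nat) (D T : Type)
    (M : mapping_transformation R N D T) (A : approx_scheme R N D D)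
    (f : D -> R) : Prop :=
  interpolates (sampling A) (samples f (sampling A))
    (operator (transformed M A) (samples f (sampling A))).

(* Main.v *)
Require Import Defs.
From mathcomp Require Import all_boot all_order all_algebra.
From mathcomp Require Import boolp classical_sets functions reals.
From mathcomp Require mpoly.

(** Everything reduces to two facts.

    An expansion in functions B_j takes at the nodes the values A c, where A is
    the collocation matrix and c the coefficient vector, so the interpolant with
    c = A^-1 y reproduces y as soon as A is invertible ([interpolantP]). A square
    matrix is invertible when its kernel is trivial; this holds for kernel
    matrices, since c^T A c > 0 rules out A c = 0 with c != 0
    ([kernel_interpolantP]), and for a uniquely solvable basis, since c = 0
    already interpolates the zero data ([uniquely_solvable_unitmx]).

    Transforming the scheme does not disturb this at the nodes. A pullback by a
    map s takes at x_i the value of the original approximant at s x_i, so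
    interpolation at the image nodes is interpolation at the x_i; for kernels
    the injectivity of the lifting keeps the image nodes distinct. A quotient
    whose denominator does not vanish at x_i takes the value f_i there exactly
    when its numerator is f_i times its denominator ([interpolates_quotient]);
    rescaling is the case where the denominator is 1 at every node. *)

Set Implicit Arguments.
Unset Strict Implicit.
Unset Printing Implicit Defensive.

Import Order.TTheory GRing.Theory Num.Theory.
Local Open Scope classical_set_scope.
Local Open Scope ring_scope.

(** [kermx] is a row kernel while coefficient vectors are columns, hence the
    passage to the transpose. *)
Lemma unitmx_ker0 (F : fieldType) n (A : 'M[F]_n) :
  (forall c : 'cV[F]_n, A *m c = 0 -> c = 0) -> A \in unitmx.
Proof.
move=> A_inj; rewrite -unitmx_tr -row_free_unit -kermx_eq0.
apply/eqP/row_matrixP => i; rewrite row0; apply/trmx_inj; rewrite trmx0.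
by apply: A_inj; apply: trmx_inj; rewrite trmx_mul trmxK -row_mul mulmx_ker
  row0 trmx0.
Qed.

Lemma posdefmx_unitmx (R : realType) n (A : 'M[R]_n) :
  posdefmx A -> A \in unitmx.
Proof.
move=> A_pos; apply: unitmx_ker0 => c Ac0; apply/eqP; apply: contraT => /A_pos.
by rewrite -mulmxA Ac0 mulmx0 mxE ltxx.
Qed.

Section Interpolants.
Context {R : realType} {N : nat} {T : Type}.
Implicit Types (B : 'I_N -> T -> R) (K : T -> T -> R) (x : 'I_N -> T)
  (y : 'cV[R]_N) (P Q : T -> R).

Lemma lincomb_node B x (c : 'cV[R]_N) i :
  lincomb B c (x i) = (collocation_mx B x *m c) i 0.
Proof. by rewrite mxE; apply: eq_bigr => j _; rewrite mxE mulrC. Qed.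

Lemma interpolantP B x y :
  collocation_mx B x \in unitmx -> interpolates x y (interpolant B x y).
Proof. by move=> Bx_unit i; rewrite /interpolant lincomb_node mulKVmx. Qed.

Lemma uniquely_solvable_unitmx B x :
  uniquely_solvable B x -> collocation_mx B x \in unitmx.
Proof.
move=> Bx_solv; apply: unitmx_ker0 => c Bc0.
have [c0 [_ c0_uniq]] := Bx_solv 0.
rewrite -(c0_uniq c); last by move=> i; rewrite lincomb_node Bc0.
by apply: c0_uniq => i; rewrite lincomb_node mulmx0.
Qed.

Lemma kernel_interpolantP K x y :
  strictly_posdef K -> injective x ->
  interpolates x y (kernel_interpolant K x y).
Proof.
by move=> K_pos x_inj; apply/interpolantP/posdefmx_unitmx/K_pos.
Qed.

Lemma interpolates_quotient x y P Q :
  (forall i, P (x i) = y i 0 * Q (x i)) -> (forall i, Q (x i) != 0) ->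
  interpolates x y (fun t => P t / Q t).
Proof. by move=> PQ Q0 i; rewrite PQ mulfK. Qed.

End Interpolants.

(** A point is recovered from its lift as the first block of coordinates. *)
Lemma lifting_inj (R : realType) d (Omega : set 'rV[R]_d) (psi : Omega -> R) :
  injective (lifting psi).
Proof. by move=> v w /eq_row_mx[/val_inj]. Qed.

Theorem proposition4p1 (R : realType) (d N : nat) (Omega : set 'rV[R]_d)
    (x : 'I_N -> Omega) (f : Omega -> R) (x_inj : injective x) :
  (* general principle *)
  (forall (T : Type) (V : fdspace R Omega) (I : 'cV[R]_N -> Omega -> R)
      (M : mapping_transformation R N Omega T),
     (forall i, map_operator M I (samples f x) (x i) = f (x i)) ->
     preserves_interpolation M (ApproxScheme x V I) f) /\
  (* (i) rescaled method *)
  (forall K : Omega -> Omega -> R, strictly_posdef K ->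
     let Pf := kernel_interpolant K x (samples f x) in
     let P1 := kernel_interpolant K x (samples (fun=> 1) x) in
     (forall i, P1 (x i) != 0) /\
     interpolates x (samples f x) (fun w => Pf w / P1 w)) /\
  (* (ii) variably scaled kernel interpolation *)
  (forall (K : 'rV[R]_(d + 1) -> 'rV[R]_(d + 1) -> R) (psi : Omega -> R),
     strictly_posdef K ->
     let sigma := lifting psi in
     let P := kernel_interpolant K (sigma \o x) (samples f x) in
     interpolates x (samples f x) (P \o sigma)) /\
  (* (iii) fake-node interpolation *)
  (forall (T : Type) (S : Omega -> T) (B : 'I_N -> range S -> R)
      (g : range S -> R),
     injective S ->
     let S' := onto_range S in
     let nodes := S' \o x in
     lin_indep B -> uniquely_solvable B nodes ->
     (forall i, g (nodes i) = f (x i)) ->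
     let Pg := interpolant B nodes (samples g nodes) in
     interpolates x (samples f x) (Pg \o S')) /\
  (* (iv) rational interpolation *)
  (forall (L : nat) (K Kbar : Omega -> Omega -> R)
      (p : 'I_L -> mpoly.mpoly d R)
      (alpha beta : 'cV[R]_N) (gamma : 'cV[R]_L),
     let Pg := rational_num K p x alpha gamma in
     let Ph := rational_den Kbar x beta in
     (forall i, Pg (x i) = f (x i) * Ph (x i)) ->
     (forall i, Ph (x i) != 0) ->
     interpolates x (samples f x) (fun w => Pg w / Ph w)).
Proof.
split; first by move=> T V I M If i; rewrite /= If mxE.
split.
  move=> K K_pos Pf P1.
  have P1E i : P1 (x i) = 1 by rewrite /P1 kernel_interpolantP// mxE.
  have P1_neq0 i : P1 (x i) != 0 by rewrite P1E oner_neq0.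
  split=> //; apply: interpolates_quotient => // i.
  by rewrite P1E mulr1 /Pf kernel_interpolantP.
split.
  move=> K psi K_pos sigma P i.
  exact/kernel_interpolantP/inj_comp/x_inj/lifting_inj.
split.
  move=> T S B g _ S' nodes _ B_solv gE Pg i.
  rewrite [LHS](interpolantP _ (uniquely_solvable_unitmx B_solv)).
  by rewrite !mxE gE.
move=> L K Kbar p alpha beta gamma Pg Ph PgE Ph_neq0.
by apply: interpolates_quotient => // i; rewrite PgE mxE.
Qed.
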